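(* Let $d=2$ and let $(\mathcal V,w)$ be a lattice in $\mathbf R^2$ such that $v_{i,\alpha}\in[-1,1]$ for every velocity $v_i\in\mathcal V$ and every $\alpha\in\{1,2\}$. Then $(\mathcal V,w)$ is isotropic with speed of sound $c_s=3^{-1/2}$ if and only if it is the D2Q9 lattice.
   Context: A lattice in $\mathbf R^d$ is a pair $(\mathcal V,w)$ where $\mathcal V=\{v_0=0,v_1,\dots,v_n\}\subset\mathbf R^d$ is a set of pairwise distinct velocities ($n\in\mathbf N$) and $w=(w_0,\dots,w_n)$ is a vector of strictly positive weights. It is isotropic with speed of sound $c_s>0$ if for all indices $\alpha,\beta,\gamma,\zeta\in\{1,\dots,d\}$ ($v_{i,\alpha}$ is the $\alpha$-component of $v_i$): $\sum_i w_i=1$, $\sum_i w_iv_{i,\alpha}=0$, $\sum_i w_iv_{i,\alpha}v_{i,\beta}=c_s^2\delta_{\alpha\beta}$, $\sum_i w_iv_{i,\alpha}v_{i,\beta}v_{i,\gamma}=0$, $\sum_i w_iv_{i,\alpha}v_{i,\beta}v_{i,\gamma}v_{i,\zeta}=c_s^4(\delta_{\alpha\beta}\delta_{\gamma\zeta}+\delta_{\alpha\gamma}\delta_{\beta\zeta}+\delta_{\alpha\zeta}\delta_{\beta\gamma})$. The D2Q9 lattice (up to relabelling the nonzero velocities): $n=8$, with velocity $(0,0)$ of weight $4/9$; velocities $(1,0),(0,1),(-1,0),(0,-1)$ each of weight $1/9$; velocities $(1,1),(-1,1),(-1,-1),(1,-1)$ each of weight $1/36$. *)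

(* Defs.v *)
(* Based on Mathematical Components; the real line is an arbitrary
   R : realType. *)
From HB Require Import structures.
From mathcomp Require Import all_boot all_order all_algebra.
From mathcomp Require Import reals.
Set Implicit Arguments.
Unset Strict Implicit.
Unset Printing Implicit Defensive.
Import Order.TTheory GRing.Theory Num.Theory.
Local Open Scope ring_scope.

(* The n.+1 velocities are indexed by 'I_n.+1, the index 0 carrying the null
   velocity. *)
Record lattice (R : realType) (d n : nat) := Lattice {
  velocity : 'I_n.+1 -> 'rV[R]_d;
  weight : 'I_n.+1 -> R;
  velocity0 : velocity ord0 = 0;
  velocity_inj : injective velocity;
  weight_gt0 : forall i, 0 < weight i
}.

Definition vcomp (R : realType) (d n : nat) (L : lattice R d n)
  (i : 'I_n.+1) (a : 'I_d) : R := velocity L i ord0 a.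

Definition kronecker (R : realType) (d : nat) (a b : 'I_d) : R := (a == b)%:R.

Record isotropic (R : realType) (d n : nat) (L : lattice R d n) (cs : R) :
    Prop := Isotropic {
  speed_gt0 : 0 < cs;
  moment0 : \sum_i weight L i = 1;
  moment1 : forall a : 'I_d, \sum_i weight L i * vcomp L i a = 0;
  moment2 : forall a b : 'I_d,
    \sum_i weight L i * vcomp L i a * vcomp L i b = cs ^+ 2 * kronecker R a b;
  moment3 : forall a b c : 'I_d,
    \sum_i weight L i * vcomp L i a * vcomp L i b * vcomp L i c = 0;
  moment4 : forall a b c e : 'I_d,
    \sum_i weight L i * vcomp L i a * vcomp L i b * vcomp L i c * vcomp L i e =
    cs ^+ 4 * (kronecker R a b * kronecker R c e
               + kronecker R a c * kronecker R b e
               + kronecker R a e * kronecker R b c)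
}.

(* Equality of lattices up to relabelling the nonzero velocities; the bijection
   forces n = m. *)
Definition same_lattice (R : realType) (d n m : nat)
  (L : lattice R d n) (M : lattice R d m) : Prop :=
  exists f : 'I_n.+1 -> 'I_m.+1,
    [/\ bijective f, f ord0 = ord0,
        forall i, velocity L i = velocity M (f i)
      & forall i, weight L i = weight M (f i)].

Definition D2Q9_coords : seq (int * int) :=
  [:: (0, 0);
      (1, 0); (0, 1); (-1, 0); (0, -1);
      (1, 1); (-1, 1); (-1, -1); (1, -1)].

Definition D2Q9_velocity (R : realType) (i : 'I_9) : 'rV[R]_2 :=
  let p := nth (0, 0) D2Q9_coords i in
  \row_(a < 2) (if a == ord0 then p.1 else p.2)%:~R.

Definition D2Q9_weight (R : realType) (i : 'I_9) : R :=
  nth 0 [:: 4 / 9;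
            1 / 9; 1 / 9; 1 / 9; 1 / 9;
            1 / 36; 1 / 36; 1 / 36; 1 / 36] i.

Lemma D2Q9_velocity0 (R : realType) : D2Q9_velocity R ord0 = 0.
Proof. by apply/rowP => a; rewrite !mxE /=; case: ifP. Qed.

Lemma D2Q9_velocity_inj (R : realType) : injective (D2Q9_velocity R).
Proof.
move=> i j /rowP eq_ij; apply/val_inj => /=.
have:= eq_ij 0; have:= eq_ij 1; rewrite !mxE /= => /intr_inj e2 /intr_inj e1.
apply/eqP; rewrite -(nth_uniq (0, 0) (s := D2Q9_coords)) //; apply/eqP.
by rewrite [LHS]surjective_pairing e1 e2 -surjective_pairing.
Qed.

Lemma D2Q9_weight_gt0 (R : realType) (i : 'I_9) : 0 < D2Q9_weight R i.
Proof.
by case: i; do 9 (case; first by rewrite /D2Q9_weight /= divr_gt0 ?ltr0n).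
Qed.

Definition D2Q9 (R : realType) : lattice R 2 8 :=
  Lattice (D2Q9_velocity0 R) (@D2Q9_velocity_inj R) (@D2Q9_weight_gt0 R).

(* Main.v *)
Require Import Defs.
From mathcomp Require Import all_boot all_order all_algebra.
From mathcomp Require Import reals ring lra.
Import Order.TTheory GRing.Theory Num.Theory.
Local Open Scope ring_scope.

(** The moments of orders 2 and 4 give [\sum_i w_i x_i^2 (1 - x_i^2) = 0] for
    each coordinate [x], a sum of nonnegative terms, so that every coordinate
    is -1, 0 or 1. On these values the indicator of a point is a polynomial of
    degree at most 2 in each coordinate, so the moments determine the weight
    carried by each of the nine points; these weights being positive, all nine
    points are velocities. *)

Lemma sqr_cs (R : realType) : (Num.sqrt (3 : R))^-1 ^+ 2 = 1 / 3.
Proof. by rewrite exprVn sqr_sqrtr ?ler0n // div1r. Qed.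

Lemma pow4_cs (R : realType) : (Num.sqrt (3 : R))^-1 ^+ 4 = 1 / 9.
Proof. by rewrite (exprM _ 2 2) sqr_cs; field. Qed.

(** Membership of a coordinate in {-1, 0, 1} is encoded as one polynomial equation, the form in
    which [interpE] and [D2Q9_velocityP] take it. *)
Lemma isotropic_comp_cube {R : realType} {d n : nat} {L : lattice R d n}
    (bounded : forall i a, -1 <= vcomp L i a <= 1) :
  isotropic L (Num.sqrt (3 : R))^-1 ->
  forall i a, vcomp L i a ^+ 3 = vcomp L i a.
Proof.
move=> iso i a; set x := vcomp L ^~ a.
have x2_le1 j : 0 <= 1 - x j ^+ 2.
  by have /andP[lo hi] := bounded j a; rewrite /x; nra.
have term_ge0 j : true -> 0 <= weight L j * (x j ^+ 2 * (1 - x j ^+ 2)).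
  by move=> _; rewrite pmulr_rge0 ?weight_gt0 // mulr_ge0 ?sqr_ge0.
have : \sum_j weight L j * (x j ^+ 2 * (1 - x j ^+ 2)) = 0.
  transitivity (\sum_j weight L j * x j * x j
                - \sum_j weight L j * x j * x j * x j * x j).
    by rewrite -sumrB; apply: eq_bigr => j _; ring.
  (* The two sums are [cs ^+ 2] and [3 * cs ^+ 4], both equal to 1/3 for this speed of sound. *)
  rewrite (moment2 iso) (moment4 iso) sqr_cs pow4_cs /kronecker eqxx /=.
  by field.
move/eqP; rewrite psumr_eq0 // => /allP/(_ i (mem_index_enum i)) /=.
rewrite mulf_eq0 gt_eqF ?weight_gt0 //= mulf_eq0 sqrf_eq0 -/(x i).
by case/orP => /eqP e; [rewrite e expr0n | rewrite exprS -(subr0_eq e) mulr1].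
Qed.

Lemma cube_fixed {R : realType} {x : R} :
  x ^+ 3 = x -> [\/ x = 0, x = 1 | x = -1].
Proof.
move=> e; have /eqP : x * ((x - 1) * (x + 1)) = 0.
  by transitivity (x ^+ 3 - x); [ring | rewrite e subrr].
rewrite !mulf_eq0 subr_eq0 addr_eq0.
by case/or3P => /eqP; [constructor 1 | constructor 2 | constructor 3].
Qed.

(* For a, x in {-1, 0, 1} this is 1 if x = a and 0 otherwise. *)
Definition interp {R : realType} (a x : R) : R :=
  (1 - a ^+ 2) + a / 2 * x + (3 / 2 * a ^+ 2 - 1) * x ^+ 2.

Lemma interpE {R : realType} {a x : R} :
  a ^+ 3 = a -> x ^+ 3 = x -> interp a x = (x == a)%:R.
Proof.
have neq10 : (1 : R) == 0 = false by apply: oner_eq0.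
have neqN10 : (-1 : R) == 0 = false by rewrite oppr_eq0 oner_eq0.
have neq1N1 : (1 : R) == -1 = false by rewrite -addr_eq0 (pnatr_eq0 R 2).
move=> /cube_fixed[] -> /cube_fixed[] ->; rewrite /interp ?eqxx
  ?(eq_sym 0) ?(eq_sym (-1) 1) ?neq10 ?neqN10 ?neq1N1 /=; by field.
Qed.

(** The product expands into monomials of degree at most 2 in each coordinate, whose moments
    isotropy prescribes. Odd ones vanish and that of x^2 y^2 is 1/9 = (1/3)(1/3), so the result
    factors; each factor is 1 - a^2 + (3a^2/2 - 1)/3. *)
Lemma isotropic_interp {R : realType} {n : nat} {L : lattice R 2 n} (a b : R) :
  isotropic L (Num.sqrt (3 : R))^-1 ->
  \sum_i weight L i * (interp a (vcomp L i 0) * interp b (vcomp L i 1)) =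
  (2 / 3 - a ^+ 2 / 2) * (2 / 3 - b ^+ 2 / 2).
Proof.
move=> iso; rewrite /interp.
set a0 := 1 - a ^+ 2; set a1 := a / 2; set a2 := 3 / 2 * a ^+ 2 - 1.
set b0 := 1 - b ^+ 2; set b1 := b / 2; set b2 := 3 / 2 * b ^+ 2 - 1.
pose w := weight L; pose x := vcomp L ^~ 0; pose y := vcomp L ^~ 1.
transitivity (a0 * b0 * (\sum_i w i)
  + a1 * b0 * (\sum_i w i * x i) + a0 * b1 * (\sum_i w i * y i)
  + a2 * b0 * (\sum_i w i * x i * x i) + a1 * b1 * (\sum_i w i * x i * y i)
  + a0 * b2 * (\sum_i w i * y i * y i)
  + a2 * b1 * (\sum_i w i * x i * x i * y i)
  + a1 * b2 * (\sum_i w i * x i * y i * y i)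
  + a2 * b2 * (\sum_i w i * x i * x i * y i * y i)).
  rewrite !mulr_sumr -!big_split /=; apply: eq_bigr => i _.
  by rewrite /w /x /y; ring.
rewrite (moment0 iso) !(moment1 iso) !(moment2 iso) !(moment3 iso).
rewrite (moment4 iso) sqr_cs pow4_cs /kronecker /=.
by rewrite /a0 /a1 /a2 /b0 /b1 /b2; field.
Qed.

Lemma D2Q9_vcomp_cube (R : realType) (j : 'I_9) (a : 'I_2) :
  vcomp (D2Q9 R) j a ^+ 3 = vcomp (D2Q9 R) j a.
Proof.
rewrite /vcomp /= mxE -rmorphXn; congr (_%:~R).
by case: ifP => _; case: j; do 9 (case=> //).
Qed.

(** The weights are products of the one-dimensional weights 2/3 at 0 and 1/6 at -1 and 1; this form
    matches the value in [isotropic_interp]. *)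
Lemma D2Q9_weightE (R : realType) (j : 'I_9) :
  weight (D2Q9 R) j = (2 / 3 - vcomp (D2Q9 R) j 0 ^+ 2 / 2)
                      * (2 / 3 - vcomp (D2Q9 R) j 1 ^+ 2 / 2).
Proof.
rewrite /vcomp /= !mxE /D2Q9_weight.
by case: j; do 9 (case=> [_ /=|]; first by field); move=> m.
Qed.

Lemma ord2_cases (a : 'I_2) : a = 0 \/ a = 1.
Proof.
case: (unliftP ord0 a) => [k|] ->; last by left.
by right; rewrite ord1; apply: val_inj.
Qed.

Lemma row2_eq {R : realType} {u v : 'rV[R]_2} :
  u 0 0 = v 0 0 -> u 0 1 = v 0 1 -> u = v.
Proof.
by move=> e0 e1; apply/rowP => a; case: (ord2_cases a) => ->.
Qed.

Lemma D2Q9_velocityP {R : realType} {v : 'rV[R]_2} :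
  v 0 0 ^+ 3 = v 0 0 -> v 0 1 ^+ 3 = v 0 1 ->
  exists j, v = velocity (D2Q9 R) j.
Proof.
move=> /cube_fixed e0 /cube_fixed e1.
have ext j : v 0 0 = velocity (D2Q9 R) j 0 0 ->
    v 0 1 = velocity (D2Q9 R) j 0 1 -> exists j, v = velocity (D2Q9 R) j.
  by move=> h0 h1; exists j; apply: row2_eq.
case: e0 e1 => e0 [] e1;
  (* Positions in [D2Q9_coords]: one row for each first coordinate 0, 1, -1, and within a row the
     second coordinate runs through 0, 1, -1. *)
  [ apply: (ext (inord 0)) | apply: (ext (inord 2)) | apply: (ext (inord 4))
  | apply: (ext (inord 1)) | apply: (ext (inord 5)) | apply: (ext (inord 8))
  | apply: (ext (inord 3)) | apply: (ext (inord 6)) | apply: (ext (inord 7)) ];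
  by rewrite /= /D2Q9_velocity mxE inordK //= ?e0 ?e1 ?mulrN1z.
Qed.

Lemma D2Q9_isotropic (R : realType) :
  isotropic (D2Q9 R) (Num.sqrt (3 : R))^-1.
Proof.
have wE : weight (D2Q9 R) = @D2Q9_weight R by [].
have xE i : vcomp (D2Q9 R) i 0 = (nth (0, 0) D2Q9_coords i).1%:~R.
  by rewrite /vcomp /= mxE.
have yE i : vcomp (D2Q9 R) i 1 = (nth (0, 0) D2Q9_coords i).2%:~R.
  by rewrite /vcomp /= mxE.
split; first by rewrite invr_gt0 sqrtr_gt0.
- by rewrite wE !big_ord_recl big_ord0 /D2Q9_weight /=; field.
- move=> a;
    case: (ord2_cases a) => ->;
    under eq_bigr => i _ do rewrite wE ?xE ?yE;
    rewrite !big_ord_recl big_ord0 /D2Q9_weight /=; by field.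
- move=> a b; rewrite sqr_cs /kronecker;
    case: (ord2_cases a) => ->; case: (ord2_cases b) => ->;
    under eq_bigr => i _ do rewrite wE ?xE ?yE;
    rewrite !big_ord_recl big_ord0 /D2Q9_weight /=; by field.
- move=> a b c;
    case: (ord2_cases a) => ->; case: (ord2_cases b) => ->;
    case: (ord2_cases c) => ->;
    under eq_bigr => i _ do rewrite wE ?xE ?yE;
    rewrite !big_ord_recl big_ord0 /D2Q9_weight /=; by field.
- move=> a b c e; rewrite pow4_cs /kronecker;
    case: (ord2_cases a) => ->; case: (ord2_cases b) => ->;
    case: (ord2_cases c) => ->; case: (ord2_cases e) => ->;
    under eq_bigr => i _ do rewrite wE ?xE ?yE;
    rewrite !big_ord_recl big_ord0 /D2Q9_weight /=; by field.
Qed.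

Lemma same_lattice_isotropic {R : realType} {d n m : nat}
    {L : lattice R d n} {M : lattice R d m} {cs : R} :
  same_lattice L M -> isotropic M cs -> isotropic L cs.
Proof.
case=> f [bij_f _ eq_v eq_w] iso.
have eq_c i a : vcomp L i a = vcomp M (f i) a by rewrite /vcomp eq_v.
have reix (F : 'I_n.+1 -> R) (G : 'I_m.+1 -> R) :
    (forall i, F i = G (f i)) -> \sum_i F i = \sum_j G j.
  by move=> FG; rewrite (reindex f) /=; [apply: eq_bigr | apply: onW_bij].
split; first exact: speed_gt0 iso.
- by apply: etrans (moment0 iso); apply: reix.
- move=> a; apply: etrans (moment1 iso a); apply: reix => i.
  by rewrite eq_w !eq_c.
- move=> a b; apply: etrans (moment2 iso a b); apply: reix => i.
  by rewrite eq_w !eq_c.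
- move=> a b c; apply: etrans (moment3 iso a b c); apply: reix => i.
  by rewrite eq_w !eq_c.
- move=> a b c e; apply: etrans (moment4 iso a b c e); apply: reix => i.
  by rewrite eq_w !eq_c.
Qed.

Theorem corollary21 (R : realType) (n : nat) (L : lattice R 2 n)
  (bounded : forall (i : 'I_n.+1) (a : 'I_2), -1 <= vcomp L i a <= 1) :
  isotropic L (Num.sqrt (3 : R))^-1 <-> same_lattice L (D2Q9 R).
Proof.
split=> [iso | same]; last exact: same_lattice_isotropic same (D2Q9_isotropic R).
have cube := isotropic_comp_cube bounded iso.
have /fin_all_exists[f eq_v] i : exists j, velocity L i = velocity (D2Q9 R) j.
  by apply: D2Q9_velocityP; apply: cube.
have inj_f : injective f.
  by move=> i k e; apply: (@velocity_inj _ _ _ L); rewrite !eq_v e.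
(* The product of the two [interp] factors at the [j]-th D2Q9 velocity is the indicator of
   [f i == j]. *)
have mass j : \sum_(i | f i == j) weight L i = weight (D2Q9 R) j.
  rewrite D2Q9_weightE -(isotropic_interp _ _ iso) big_mkcond /=.
  apply: eq_bigr => i _; rewrite !interpE ?D2Q9_vcomp_cube ?cube //.
  rewrite -natrM mulnb; have -> : (f i == j) =
    (vcomp L i 0 == vcomp (D2Q9 R) j 0) && (vcomp L i 1 == vcomp (D2Q9 R) j 1).
    rewrite /vcomp eq_v; apply/eqP/andP => [-> // | [/eqP e0 /eqP e1]].
    exact/(@velocity_inj _ _ _ (D2Q9 R))/row2_eq.
  by case: ifP => _; rewrite ?mulr1 ?mulr0.
(* An empty fibre would have mass 0, against the positivity of the D2Q9 weight. *)
have onto j : exists i, f i == j.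
  apply/existsP; apply: contraT; rewrite negb_exists => /forallP no_i.
  have := weight_gt0 (D2Q9 R) j.
  by rewrite -mass big_pred0 ?ltxx // => i; apply/negbTE.
exists f; split=> //.
- apply: (inj_card_bij inj_f); rewrite -(card_codom inj_f).
  apply/subset_leq_card/subsetP => j _.
  by have [i /eqP <-] := onto j; apply: codom_f.
- by apply: (@velocity_inj _ _ _ (D2Q9 R)); rewrite -eq_v !velocity0.
(* By injectivity the fibre of [f] over [f i] is reduced to [i], so its mass is a single weight. *)
- move=> i; rewrite -mass (big_pred1 i) // => k.
  exact: inj_eq.
Qed.
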